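(* Let $\mathbf{x}_j:\mathbb{R}\to\mathbb{R}^3$ be a bounded sub-luminal trajectory. Then for every $(t,\mathbf{x})\in\mathbb{R}\times\mathbb{R}^3$ the advanced light-cone condition $$t_j^{+}=t+|\mathbf{x}-\mathbf{x}_j(t_j^{+})|$$ has a unique solution $t_j^{+}=t_j^{+}(t,\mathbf{x})\in\mathbb{R}$, and the retarded light-cone condition $$t_j^{-}=t-|\mathbf{x}-\mathbf{x}_j(t_j^{-})|$$ has a unique solution $t_j^{-}=t_j^{-}(t,\mathbf{x})\in\mathbb{R}$.
   Context: The speed of light is $c=1$ and $|\cdot|$ is the Euclidean norm on $\mathbb{R}^3$. A bounded trajectory is a continuous function $\mathbf{x}_j:\mathbb{R}\to\mathbb{R}^3$ with bounded image; trajectories are assumed continuous and piecewise differentiable, with velocity discontinuities at most on a countable set of points. A trajectory is sub-luminal if its velocity exists and satisfies $|\dot{\mathbf{x}}_j(t)|<1$ for all $t$ with the possible exception of a countable set. *)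

(* Defs.v *)
From HB Require Import structures.
From mathcomp Require Import all_boot all_order all_algebra.
From mathcomp Require Import all_classical all_reals all_analysis.

Set Implicit Arguments.
Unset Strict Implicit.
Unset Printing Implicit Defensive.

Import Order.TTheory GRing.Theory Num.Theory.
Import numFieldNormedType.Exports.

Local Open Scope classical_set_scope.
Local Open Scope ring_scope.

(* The library norm `|v| on 'rV[R]_n is the sup norm. It induces the usual
   topology, boundedness and differentiability on R^n, but lengths and speeds
   have to be measured with the Euclidean norm. *)
Definition enorm (R : realType) (n : nat) (v : 'rV[R]_n) : R :=
  Num.sqrt (\sum_(i < n) v 0 i ^+ 2).

(* derive1 x t is a junk value when x is not derivable at t, hence continuity of
   the velocity is taken relative to the set where the velocity exists. *)
Definition velocity_continuous_at (R : realType) (x : R -> 'rV[R]_3) (t : R) :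
    Prop :=
  derivable x t 1 /\
  derive1 x @ within [set s | derivable x s 1] (nbhs t) --> derive1 x t.

Definition trajectory (R : realType) (x : R -> 'rV[R]_3) : Prop :=
  continuous x /\ countable [set t | ~ velocity_continuous_at x t].

Definition bounded_trajectory (R : realType) (x : R -> 'rV[R]_3) : Prop :=
  trajectory x /\ bounded_set (range x).

Definition sub_luminal (R : realType) (x : R -> 'rV[R]_3) : Prop :=
  countable [set t | ~ (derivable x t 1 /\ enorm (derive1 x t) < 1)].

(* Main.v *)
(* A continuous real function whose derivative exists and is positive off a
   countable set D is increasing: if f b < f a with a < b, choose a value y
   strictly between f b and f a outside the countable set f(D); at the last
   point of [a, b] where f >= y the derivative exists but cannot be positive.
   Hence a sub-luminal trajectory satisfies |x(b) - x(a)| < b - a for a < b, and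
   F(s) = t +- |x - x_j(s)| is bounded with |F(b) - F(a)| < b - a, so that
   s - F(s) is continuous, increasing and changes sign. *)
Require Import Defs.
From HB Require Import structures.
From mathcomp Require Import all_boot all_order all_algebra.
From mathcomp Require Import all_classical all_reals all_analysis.
From mathcomp Require Import ring lra.

Set Implicit Arguments.
Unset Strict Implicit.
Unset Printing Implicit Defensive.

Import Order.TTheory GRing.Theory Num.Theory.
Import numFieldNormedType.Exports.

Local Open Scope classical_set_scope.
Local Open Scope ring_scope.

(** Otherwise []a, b[] would lie in [D] and be Lebesgue-null, while its measure is [b - a > 0]. *)
Lemma countable_itv_avoid (R : realType) (D : set R) (a b : R) :
  countable D -> a < b -> exists2 y, a < y < b & ~ D y.
Proof.
move=> cD ab; apply: contrapT => noy.
have abD : `]a, b[ `<=` D.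
  move=> y /=; rewrite in_itv /= => yab; apply: contrapT => Dy.
  by apply: noy; exists y.
have : lebesgue_measure (`]a, b[ : set R) = 0%E.
  exact/countable_lebesgue_measure0/(sub_countable (subset_card_le abD)).
rewrite lebesgue_measure_itv /= lte_fin ab => /eqP.
by rewrite -EFinB eqe subr_eq0 gt_eqF.
Qed.

Lemma derive1_gt0_right_lt (R : realType) (f : R -> R) (c b : R) :
  derivable f c 1 -> 0 < derive1 f c -> c < b ->
  exists2 s, c < s < b & f c < f s.
Proof.
move=> df; rewrite derive1E => f' cb.
have right_lt : \forall h \near 0^'+, f c < f (c + h).
  have /(cvgr_gt _)/(_ _ f') := cvg_dnbhs_at_right df.
  apply: filterS2 (nbhs_right_gt 0) => h h0 /=.
  by rewrite [h%:A]mulr1 [c + h]addrC pmulr_rgt0 ?invr_gt0// subr_gt0.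
near (0:R)^'+ => h; exists (c + h); last by near: h.
rewrite ltrDl -ltrBrDl; apply/andP; split; near: h.
  exact: nbhs_right_gt.
by apply: nbhs_right_lt; rewrite subr_gt0.
Unshelve. all: by end_near. Qed.

Lemma derive1_gt0_nondecreasing (R : realType) (f : R -> R) (D : set R) :
  continuous f -> countable D ->
  (forall s, ~ D s -> derivable f s 1 /\ 0 < derive1 f s) ->
  {homo f : a b / a <= b}.
Proof.
move=> cf cD f'_gt0 a b; rewrite le_eqVlt => /predU1P[->//|ab].
rewrite leNgt; apply/negP => fba.
have cfD : countable (f @` D) := sub_countable (card_image_le _ _) cD.
have [y /andP[fby yfa] Dy] := countable_itv_avoid cfD fba.
pose E := [set s | a <= s <= b /\ y <= f s].
have Ea : E a by split; [rewrite lexx ltW|exact: ltW].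
have supE : has_sup E by split; [exists a|exists b => s [/andP[]]].
have ac : a <= sup E by apply: ub_le_sup => //; case: supE.
have cb : sup E <= b by apply: ge_sup; [exists a|move=> s [/andP[]]].
(* If [f (sup E) < y], continuity keeps [f] below [y] on a ball around [sup E], yet that ball
   contains a point of [E]. *)
have yc : y <= f (sup E).
  rewrite leNgt; apply/negP => fcy.
  have /nbhs_ballP[e /= e0 ball_e] : \forall s \near sup E, f s < y.
    exact: (cvgr_lt _ (cf (sup E))).
  have [s Es cs] := sup_adherent e0 supE.
  have : f s < y.
    apply: ball_e; rewrite /ball /= ger0_norm ?subr_ge0.
      by rewrite ltrBlDl -ltrBlDr.
    by apply: ub_le_sup => //; case: supE.
  by case: Es => _ ys; rewrite ltNge ys.
have {cb}cb : sup E < b.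
  by rewrite lt_neqAle cb andbT; apply: contraPneq fby => <-; rewrite ltNge yc.
have right_lt s : sup E < s <= b -> f s < y.
  move=> /andP[cs sb]; rewrite ltNge; apply/negP => ys.
  have : s <= sup E.
    apply: ub_le_sup; [by case: supE|split=> //].
    by rewrite sb (le_trans ac)// ltW.
  by rewrite leNgt cs.
have fc : f (sup E) = y.
  apply/eqP; rewrite eq_le yc andbT leNgt; apply/negP => ylt.
  have /nbhs_ballP[e /= e0 ball_e] : \forall s \near sup E, y < f s.
    exact: (cvgr_gt _ (cf (sup E))).
  (* To the right of [sup E], inside the ball where [f > y], and capped at [b] so that [right_lt]
     applies and contradicts this. *)
  pose s := Num.min b (sup E + e / 2).
  have cs : sup E < s by rewrite lt_min cb/= ltrDl divr_gt0.
  have : f s < y by apply: right_lt; rewrite cs ge_min lexx.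
  apply/negP; rewrite -leNgt ltW//; apply: ball_e.
  rewrite /ball /= ltr0_norm ?subr_lt0// opprB ltrBlDl gt_min ltrD2l.
  by rewrite orbC ltr_pdivrMr// ltr_pMr// ltr1n.
(* Since [y] avoids the image of [D], the derivative at [sup E] is positive, so [f] exceeds [y]
   somewhere in []sup E, b[], against [right_lt]. *)
have Dc : ~ D (sup E) by move=> Dc; apply: Dy; exists (sup E).
have [df f'] := f'_gt0 _ Dc.
have [s /andP[cs sb]] := derive1_gt0_right_lt df f' cb.
apply/negP; rewrite -leNgt fc ltW//; apply: right_lt.
by rewrite cs ltW.
Qed.

(** If [f a = f b], monotonicity makes [f] constant on [[a, b]], which a positive derivative at a
    point of []a, b[] off [D] forbids. *)
Lemma derive1_gt0_increasing (R : realType) (f : R -> R) (D : set R) :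
  continuous f -> countable D ->
  (forall s, ~ D s -> derivable f s 1 /\ 0 < derive1 f s) ->
  {homo f : a b / a < b}.
Proof.
move=> cf cD f'_gt0 a b ab.
have f_le := derive1_gt0_nondecreasing cf cD f'_gt0.
have fab := f_le _ _ (ltW ab).
rewrite lt_neqAle fab andbT; apply/eqP => fE.
have [c /andP[ac cb] Dc] := countable_itv_avoid cD ab.
have [df f'] := f'_gt0 _ Dc.
have [s /andP[cs sb]] := derive1_gt0_right_lt df f' cb.
apply/negP; rewrite -leNgt (@le_trans _ _ (f b))//.
  by apply: f_le; exact: ltW.
by rewrite -fE; apply: f_le; exact: ltW.
Qed.

Section euclidean.
Context (R : realType) (n : nat).
Implicit Types u v : 'rV[R]_n.

Lemma sqr_enorm u : enorm u ^+ 2 = \sum_i u 0 i ^+ 2.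
Proof. by rewrite sqr_sqrtr// sumr_ge0// => i _; exact: sqr_ge0. Qed.

Lemma enorm_ge0 u : 0 <= enorm u.
Proof. exact: sqrtr_ge0. Qed.

Lemma enormN u : enorm (- u) = enorm u.
Proof. by rewrite /enorm; under eq_bigr do rewrite mxE sqrrN. Qed.

Lemma enorm_eq0 u : enorm u = 0 -> u = 0.
Proof.
move=> u0; have : \sum_i u 0 i ^+ 2 = 0 by rewrite -sqr_enorm u0 expr0n.
move=> /eqP; rewrite psumr_eq0 => [/allP u0i|i _]; last exact: sqr_ge0.
apply/rowP => i; rewrite mxE; apply/eqP; rewrite -sqrf_eq0.
by apply: u0i; rewrite mem_index_enum.
Qed.

(** The squared length of [|v| u - |u| v] is [2 |u| |v| (|u| |v| - <u, v>)]. It is nonnegative, and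
    dividing by [|u| |v|] requires treating null vectors apart. *)
Lemma cauchy_schwarz_enorm u v : \sum_i u 0 i * v 0 i <= enorm u * enorm v.
Proof.
have [u0|u0] := eqVneq (enorm u) 0.
  by rewrite u0 mul0r (enorm_eq0 u0) big1// => i _; rewrite mxE mul0r.
have [v0|v0] := eqVneq (enorm v) 0.
  by rewrite v0 mulr0 (enorm_eq0 v0) big1// => i _; rewrite mxE mulr0.
have uv_gt0 : 0 < enorm u * enorm v.
  by rewrite mulr_gt0// lt_neqAle eq_sym ?u0 ?v0 enorm_ge0.
have : 0 <= \sum_i (enorm v * u 0 i - enorm u * v 0 i) ^+ 2.
  by apply: sumr_ge0 => i _; exact: sqr_ge0.
have -> : \sum_i (enorm v * u 0 i - enorm u * v 0 i) ^+ 2 =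
    enorm v ^+ 2 * (\sum_i u 0 i ^+ 2) + enorm u ^+ 2 * (\sum_i v 0 i ^+ 2)
    - 2 * (enorm u * enorm v) * (\sum_i u 0 i * v 0 i).
  rewrite !mulr_sumr -big_split -sumrB /=; apply: eq_bigr => i _; ring.
rewrite -!sqr_enorm => ge0; rewrite -(ler_pM2l uv_gt0); nra.
Qed.

Lemma ler_enormD u v : enorm (u + v) <= enorm u + enorm v.
Proof.
rewrite -(@ler_pXn2r _ 2)// ?nnegrE ?addr_ge0 ?enorm_ge0//.
rewrite sqr_enorm sqrrD !sqr_enorm.
have -> : \sum_i (u + v) 0 i ^+ 2 =
    \sum_i u 0 i ^+ 2 + (\sum_i u 0 i * v 0 i) *+ 2 + \sum_i v 0 i ^+ 2.
  rewrite -sumrMnl -!big_split /=; apply: eq_bigr => i _.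
  by rewrite mxE sqrrD.
by rewrite lerD2r lerD2l lerMn2r cauchy_schwarz_enorm.
Qed.

Lemma ler_dist_enorm u v : `|enorm u - enorm v| <= enorm (u - v).
Proof.
have := ler_enormD (u - v) v; have := ler_enormD (v - u) u.
by rewrite !subrK -opprB enormN ler_norml; lra.
Qed.

(** Each of the [n] squared coordinates is at most the squared sup norm. This transfers boundedness
    of the trajectory to Euclidean length. *)
Lemma enorm_le_norm u : enorm u <= Num.sqrt n%:R * `|u|.
Proof.
rewrite -(@ler_pXn2r _ 2)// ?nnegrE ?mulr_ge0 ?enorm_ge0 ?sqrtr_ge0//.
rewrite sqr_enorm exprMn sqr_sqrtr ?ler0n// mulr_natl.
rewrite -[X in _ *+ X]card_ord -sumr_const; apply: ler_sum => i _.
rewrite -real_normK ?num_real// ler_pXn2r// ?nnegrE//.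
rewrite [leRHS]/Num.Def.normr /= mx_normrE.
exact: (le_bigmax _ (fun ij : 'I_1 * 'I_n => `|u ij.1 ij.2|) (0, i)).
Qed.

End euclidean.

(* Testing the displacement x b - x a against itself turns the vector-valued
   mean value inequality into monotonicity of s |-> s |u| - <u, x s>. *)
Lemma sub_luminal_displacement (R : realType) (x : R -> 'rV[R]_3) (a b : R) :
  continuous x -> sub_luminal x -> a < b -> enorm (x b - x a) < b - a.
Proof.
move=> cx subx ab; set u := x b - x a.
have [u0|u0] := eqVneq (enorm u) 0; first by rewrite u0 subr_gt0.
have u_gt0 : 0 < enorm u by rewrite lt_neqAle eq_sym u0 enorm_ge0.
pose f s := s * enorm u - \sum_i u 0 i * x s 0 i.
have cf : continuous f.
  move=> s; apply: cvgB; first by apply: cvgMr_tmp; exact: cvg_id.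
  apply: cvg_big => [|i _]; first exact: add_continuous.
  apply: cvgMl_tmp; apply: (cvg_comp x (fun v : 'rV[R]_3 => v 0 i) (cx s)).
  exact: coord_continuous.
have f'_gt0 s : ~ ~ (derivable x s 1 /\ enorm (derive1 x s) < 1) ->
    derivable f s 1 /\ 0 < derive1 f s.
  move=> /contrapT[dx x'_lt1].
  have dxi i : is_derive s 1 (fun r => x r 0 i) (derive1 x s 0 i).
    have /derivable_mxP/(_ 0 i) di := dx.
    by rewrite derive1E derive_mx// mxE; exact: derivableP.
  have df : is_derive s 1 f (enorm u - \sum_i u 0 i * derive1 x s 0 i).
    have -> : f = enorm u \*: id - \sum_i (u 0 i \*: (fun r => x r 0 i)).
      apply/funext => r; rewrite /f fctE fct_sumE; congr (_ - _).
      exact: mulrC.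
    by apply: is_deriveB; apply: is_derive_eq; exact: mulr1.
  split; first by [].
  rewrite derive1E derive_val subr_gt0.
  (* By Cauchy-Schwarz, [<u, x'> <= |u| |x'| < |u|], as the speed is below 1. *)
  apply: le_lt_trans (cauchy_schwarz_enorm _ _) _.
  by rewrite gtr_pMr.
have := derive1_gt0_increasing cf subx f'_gt0 ab.
have sum_sub : \sum_i u 0 i * x b 0 i - \sum_i u 0 i * x a 0 i = enorm u ^+ 2.
  rewrite sqr_enorm -sumrB; apply: eq_bigr => i _.
  by rewrite -mulrBr expr2 !mxE.
(* After multiplication by [|u|] the goal is [|u|^2 < (b - a) |u|], which is [f a < f b]
   rearranged. *)
move=> fab; rewrite -(ltr_pM2r u_gt0) -expr2 -sum_sub mulrBl.
by move: fab; rewrite /f; lra.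
Qed.

(** No uniform contraction factor is available, so existence comes from the intermediate value
    theorem: [s - F s] is [<= 0] at [- M] and [>= 0] at [M]. Two fixed points would be kept at their
    distance by [F], contradicting strictness. *)
Lemma strict_contraction_unique_fixpoint (R : realType) (F : R -> R) (M : R) :
  (forall s, `|F s| <= M) -> (forall a b, a < b -> `|F b - F a| < b - a) ->
  exists! s, s = F s.
Proof.
move=> FM Flt.
have Fle a b : `|F b - F a| <= `|b - a|.
  have [ab|ba|->] := ltgtP a b; last by rewrite !subrr.
    by rewrite [leRHS]gtr0_norm ?subr_gt0// ltW// Flt.
  by rewrite distrC [leRHS]distrC [leRHS]gtr0_norm ?subr_gt0// ltW// Flt.
have cF : continuous F.
  move=> s; apply/cvgrPdist_lt => e e0; near=> r.
  apply: le_lt_trans (Fle _ _) _; near: r.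
  by apply: (@cvgr_dist_lt _ _ _ _ _ id).
have M0 : 0 <= M := le_trans (normr_ge0 _) (FM 0).
have [|||s _ sE] := @IVT _ (fun s => s - F s) (- M) M 0.
- by rewrite ge0_cp.
- apply: continuous_subspaceT => s; apply: cvgB; [exact: cvg_id|exact: cF].
- have := FM M; have := FM (- M); rewrite !ler_norml => /andP[h1 _] /andP[_ h2].
  rewrite ge_min le_max; apply/andP; split; apply/orP; [left|right]; lra.
have {}sE : s = F s by apply/eqP; rewrite -subr_eq0 sE.
exists s; split=> // r rE; apply/eqP; apply: contraT.
by rewrite neq_lt => /orP[] /Flt; rewrite -sE -rE ltNge ler_norm.
Unshelve. all: by end_near. Qed.

Theorem theorem2p1 (R : realType) (xj : R -> 'rV[R]_3)
    (hbounded : bounded_trajectory xj) (hsub : sub_luminal xj)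
    (t : R) (x : 'rV[R]_3) :
  (exists! tp : R, tp = t + enorm (x - xj tp)) /\
  (exists! tm : R, tm = t - enorm (x - xj tm)).
Proof.
have [[cxj _] [M0 [_ xjM0]]] := hbounded.
have [M xjM] : exists M, forall s, `|xj s| <= M.
  (* Boundedness gives a bound by every constant strictly above [M0]. *)
  by exists (M0 + 1) => s; apply: xjM0; [rewrite ltrDl|exists s].
have dist_lt a b : a < b ->
    `|enorm (x - xj b) - enorm (x - xj a)| < b - a.
  move=> ab; apply: le_lt_trans (ler_dist_enorm _ _) _.
  rewrite opprB addrC addrA subrK -opprB enormN.
  exact: sub_luminal_displacement.
(* One bound for both [t + |x - xj s|] and [t - |x - xj s|]; the factor [sqrt 3] converts the
   sup-norm bound [M]. *)
pose B := `|t| + (enorm x + Num.sqrt 3%:R * M).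
have dist_le s : enorm (x - xj s) <= enorm x + Num.sqrt 3%:R * M.
  apply: le_trans (ler_enormD _ _) _; rewrite enormN lerD2l.
  apply: le_trans (enorm_le_norm _) _.
  exact: ler_wpM2l (sqrtr_ge0 _) _ _ (xjM s).
split; apply: (@strict_contraction_unique_fixpoint _ _ B) => [s|a b ab].
- by rewrite (le_trans (ler_normD _ _))// lerD2l ger0_norm ?enorm_ge0.
- by rewrite opprD addrACA subrr add0r; exact: dist_lt.
- by rewrite (le_trans (ler_normB _ _))// lerD2l ger0_norm ?enorm_ge0.
- by rewrite opprD opprK addrACA subrr add0r addrC distrC; exact: dist_lt.
Qed.
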